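(* Let $\mathbb{A}=(a_{i_1i_2\ldots i_m})$ be a nonnegative tensor of order $m$ and dimension $2$. If there exist $\alpha_1,\alpha_2\in[2]^{m-1}$ such that $a_{1\alpha_1}=a_{2\alpha_2}=0$, then $\mathbb{A}$ is not strongly primitive.
   Context: $[n]=\{1,\ldots,n\}$; for $i\in[n]$ and $\alpha=i_2\ldots i_m\in[n]^{m-1}$, $a_{i\alpha}=a_{ii_2\ldots i_m}$. General product: for $\mathbb{A}$ of order $m\ge2$ and $\mathbb{B}$ of order $k\ge1$, both of dimension $n$, $(\mathbb{A}\mathbb{B})_{i\alpha_1\ldots\alpha_{m-1}}=\sum_{i_2,\ldots,i_m=1}^n a_{ii_2\ldots i_m}b_{i_2\alpha_1}\cdots b_{i_m\alpha_{m-1}}$ ($\alpha_j\in[n]^{k-1}$), a tensor of order $(m-1)(k-1)+1$; it is associative, $\mathbb{A}^1=\mathbb{A}$, $\mathbb{A}^k=\mathbb{A}\mathbb{A}^{k-1}$. A nonnegative tensor $\mathbb{A}$ is strongly primitive if $\mathbb{A}^k$ is positive (all entries $>0$) for some positive integer $k$. *)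

(* Defs.v *)
From HB Require Import structures.
From mathcomp Require Import all_boot all_order all_algebra.

Set Implicit Arguments.
Unset Strict Implicit.
Unset Printing Implicit Defensive.

Import Order.TTheory GRing.Theory Num.Theory.
Local Open Scope ring_scope.

(* A tensor of order m >= 1 and dimension n over R: its entry a_{i alpha} is
   [A i alpha], with i the first index and alpha the remaining m - 1 indices.
   The index set [n] = {1, ..., n} is represented by 'I_n = {0, ..., n-1}. *)
Definition tensor (R : Type) (n m : nat) : Type :=
  'I_n -> (m.-1).-tuple 'I_n -> R.

Lemma block_index_subproof (p q : nat) (t : 'I_p) (s : 'I_q) :
  (t * q + s < p * q)%N.
Proof.
apply: (@leq_trans (t.+1 * q)); first by rewrite mulSn addnC ltn_add2r.
by rewrite leq_mul2r ltn_ord orbT.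
Qed.

Definition block_index (p q : nat) (t : 'I_p) (s : 'I_q) : 'I_(p * q) :=
  Ordinal (block_index_subproof t s).

(* If g is the concatenation alpha_1 ... alpha_p of p words of length q, then
   [block g t] is the word alpha_(t+1). *)
Definition block (T : Type) (p q : nat) (g : (p * q).-tuple T) (t : 'I_p) :
    q.-tuple T :=
  [tuple tnth g (block_index t s) | s < q].

Definition prod_order (m k : nat) : nat := (m.-1 * k.-1).+1.

Definition tensor_mul (R : pzSemiRingType) (n m k : nat)
    (A : tensor R n m) (B : tensor R n k) : tensor R n (prod_order m k) :=
  fun (i : 'I_n) (g : (m.-1 * k.-1).-tuple 'I_n) =>
    \sum_(j : (m.-1).-tuple 'I_n)
      A i j * \prod_(t < m.-1) B (tnth j t) (block g t).

Fixpoint powS_order (m k : nat) : nat :=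
  if k is k'.+1 then prod_order m (powS_order m k') else m.

(* [tensor_powS A k] is A^(k+1). The exponent is shifted because A^0 is not
   defined. *)
Fixpoint tensor_powS (R : pzSemiRingType) (n m : nat) (A : tensor R n m)
    (k : nat) : tensor R n (powS_order m k) :=
  match k return tensor R n (powS_order m k) with
  | 0 => A
  | k'.+1 => tensor_mul A (@tensor_powS R n m A k')
  end.
Arguments tensor_powS {R n m} A k.

Definition tensor_nonneg (R : numDomainType) (n m : nat)
    (A : tensor R n m) : Prop :=
  forall i alpha, 0 <= A i alpha.

Definition tensor_pos (R : numDomainType) (n m : nat)
    (A : tensor R n m) : Prop :=
  forall i alpha, 0 < A i alpha.

Definition strongly_primitive (R : numDomainType) (n m : nat)
    (A : tensor R n m) : Prop :=
  exists k : nat, (0 < k)%N /\ tensor_pos (tensor_powS A k.-1).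

(* Main.v *)
Require Import Defs.
From HB Require Import structures.
From mathcomp Require Import all_boot all_order all_algebra.
Import Order.TTheory GRing.Theory Num.Theory.
Local Open Scope ring_scope.

(** Having a zero in every row is inherited by all powers. Let [A i w = 0] and
    let [b] select a zero in each row of [B]. Since there are only two indices,
    a word [j <> w] has some letter [j_t] equal to the index other than [w_t].
    Concatenating the words [b] (other index of [w_t]) over [t] therefore gives
    a column at which every summand of [(A B) i] vanishes: the one for [w]
    because of [A], all others because of [B]. *)

(** Position [x] of [g] lies in block [x %/ q] at offset [x %% q], so blocks can be prescribed
    freely. *)
Lemma block_surj (T : Type) (p q : nat) (f : 'I_p -> q.-tuple T) :
  exists g : (p * q).-tuple T, forall t, block g t = f t.
Proof.
(* Empty blocks are treated apart: [x %% q < q] requires [q] positive. *)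
case: q f => [|q] f.
  exists (tcast (esym (muln0 p)) [tuple]) => t.
  by apply: eq_from_tnth => -[].
have div_lt (x : 'I_(p * q.+1)) : (x %/ q.+1 < p)%N by rewrite ltn_divLR.
have mod_lt (x : 'I_(p * q.+1)) : (x %% q.+1 < q.+1)%N by rewrite ltn_mod.
exists [tuple tnth (f (Ordinal (div_lt x))) (Ordinal (mod_lt x)) | x < p * q.+1].
move=> t; apply: eq_from_tnth => s; rewrite !tnth_mktuple.
congr (tnth (f _) _); apply: val_inj => /=.
  by rewrite divnMDl // divn_small ?addn0.
by rewrite modnMDl modn_small.
Qed.

(** On ['I_2], [rev_ord] swaps the two indices. *)
Lemma ord2_neq_rev (i j : 'I_2) : i != j -> rev_ord j = i.
Proof. by move=> ne_ij; apply: val_inj; case: i j ne_ij => -[|[|i]] ? [] [|[|j]]. Qed.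

Lemma tensor_mul_eq0 (R : comPzSemiRingType) (m k : nat)
    (A : tensor R 2 m) (B : tensor R 2 k) (b : 'I_2 -> (k.-1).-tuple 'I_2)
    (i : 'I_2) (w : (m.-1).-tuple 'I_2) :
  (forall j, B j (b j) = 0) -> A i w = 0 -> exists g, tensor_mul A B i g = 0.
Proof.
move=> Bb0 Aw0; have [g gE] := block_surj _ _ _ (fun t => b (rev_ord (tnth w t))).
exists g; apply: big1 => j _.
have [-> | ne_jw] := eqVneq j w; first by rewrite Aw0 mul0r.
have /existsP[t ne_t] : [exists t, tnth j t != tnth w t].
  rewrite -negb_forall; apply: contra ne_jw => /forallP eq_jw.
  by apply/eqP/eq_from_tnth => t; apply/eqP.
by rewrite (bigD1 t) //= gE (ord2_neq_rev _ _ ne_t) Bb0 mul0r mulr0.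
Qed.

Lemma tensor_powS_eq0 (R : comPzSemiRingType) (m : nat) (A : tensor R 2 m) :
  (forall i, exists w, A i w = 0) ->
  forall k i, exists g, tensor_powS A k i g = 0.
Proof.
move=> A0; elim=> [|k IHk] i; first exact: A0.
(* [IHk] only asserts existence row by row; the selector [b] is assembled from its two instances. *)
have [[b0 b0E] [b1 b1E]] := (IHk ord0, IHk ord_max); have [w Aw0] := A0 i.
apply: (@tensor_mul_eq0 _ _ _ _ _ (fun j => if j == ord0 then b0 else b1)) Aw0.
move=> j; have [-> // | /ord2_neq_rev <-] := eqVneq j ord0.
(* [rev_ord ord0] and [ord_max] have the same value but different bound proofs. *)
by rewrite -[RHS]b1E; congr (tensor_powS A k _ _); apply: val_inj.
Qed.

Theorem theorem3p7 (R : realFieldType) (m : nat) (hm : (2 <= m)%N)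
    (A : tensor R 2 m) (hA : tensor_nonneg A)
    (hzero : exists alpha1 alpha2 : (m.-1).-tuple 'I_2,
       A ord0 alpha1 = 0 /\ A ord_max alpha2 = 0) :
  ~ strongly_primitive A.
Proof.
case: hzero => a1 [a2 [Aa1 Aa2]] [k [_ pos]].
have A0 i : exists w, A i w = 0.
  have [-> | /ord2_neq_rev <-] := eqVneq i ord0; first by exists a1.
  by exists a2; rewrite -[RHS]Aa2; congr (A _ _); apply: val_inj.
have [g g0] := tensor_powS_eq0 _ _ _ A0 k.-1 ord0.
by have := pos ord0 g; rewrite g0 ltxx.
Qed.
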